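(* Let $X$ be a measurable space and let $\mathcal P(X)$ be the set of probability measures on $X$. The space $(\mathcal P(X)\times\mathcal P(X),\mathcal H^2)$, where $\mathcal H$ is the Hellinger distance, satisfies condition (NNCC-conv), and is thus an NNCC space.
   Context: The Hellinger distance is given by $\mathcal H^2(\mu,\nu)=\int_X\Big(\sqrt{\frac{d\mu}{d\lambda}(x)}-\sqrt{\frac{d\nu}{d\lambda}(x)}\Big)^2d\lambda(x)$, where $\lambda$ is any measure dominating both $\mu$ and $\nu$ (the value does not depend on $\lambda$). Condition (NNCC-conv) for a finite cost $c\colon A\times B\to\mathbb R$: for any $x_0,x_1\in A$ and $\bar y\in B$ there exists a path $\mathrm x\colon[0,1]\to A$ (an arbitrary function) with $\mathrm x(0)=x_0$, $\mathrm x(1)=x_1$ such that for every $y\in B$ the function $s\mapsto c(\mathrm x(s),\bar y)-c(\mathrm x(s),y)$ is convex on $[0,1]$. $(A\times B,c)$ is an NNCC space if for any $x_0,x_1\in A$, $\bar y\in B$ there is a path $\mathrm x\colon[0,1]\to A$ with $\mathrm x(0)=x_0$, $\mathrm x(1)=x_1$ such that for all $s\in(0,1)$ and $y\in B$, $c(\mathrm x(s),\bar y)-c(\mathrm x(s),y)\le(1-s)[c(x_0,\bar y)-c(x_0,y)]+s[c(x_1,\bar y)-c(x_1,y)]$. *)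

(* Defs.v *)
From HB Require Import structures.
From mathcomp Require Import all_boot all_order all_algebra.
From mathcomp Require Import all_classical all_reals all_analysis.
From mathcomp Require Import measurable_realfun.

Set Implicit Arguments.
Unset Strict Implicit.
Unset Printing Implicit Defensive.

Import Order.TTheory GRing.Theory Num.Theory.
Import numFieldNormedType.Exports.

Local Open Scope classical_set_scope.
Local Open Scope ring_scope.

Section NNCC.
Context {R : realType} {A B : Type}.

(* A path [0, 1] -> A is represented by a function R -> A whose values outside
   [0, 1] are irrelevant; no regularity is required. *)
Definition NNCC_conv (c : A -> B -> R) : Prop :=
  forall (x0 x1 : A) (ybar : B), exists x : R -> A,
    [/\ x 0 = x0, x 1 = x1 &
      forall y : B, convex_function (`[0, 1]%classic : set R)
        (fun s : R => c (x s) ybar - c (x s) y)].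

Definition NNCC_space (c : A -> B -> R) : Prop :=
  forall (x0 x1 : A) (ybar : B), exists x : R -> A,
    [/\ x 0 = x0, x 1 = x1 &
      forall (s : R) (y : B), 0 < s < 1 ->
        c (x s) ybar - c (x s) y <=
          (1 - s) * (c x0 ybar - c x0 y) + s * (c x1 ybar - c x1 y)].

End NNCC.

Section Hellinger.
Context {d : measure_display} {X : measurableType d} {R : realType}.
Implicit Types (mu nu : probability X R)
  (la : {sigma_finite_measure set X -> \bar R}).

(* The density of mu with respect to la. It is only meaningful when mu `<< la,
   is defined up to la-null sets, and may be negative on a la-null set, where
   Num.sqrt vanishes. *)
Definition density mu la (x : X) : R :=
  fine (Radon_Nikodym (charge_of_finite_measure mu) la x).

Definition hellinger_integrand mu nu la (x : X) : R :=
  (Num.sqrt (density mu la x) - Num.sqrt (density nu la x)) ^+ 2.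

Definition hellinger2_wrt la mu nu : R :=
  \int[la]_(x in setT) hellinger_integrand mu nu la x.

Section sum.
Variables mu nu : probability X R.

Definition prob_sum : set X -> \bar R := measure_add mu nu.

HB.instance Definition _ := Measure.on prob_sum.

Let prob_sum_fin : fin_num_fun prob_sum.
Proof.
by move=> U mU; rewrite /prob_sum measure_addE fin_numD !fin_num_measure.
Qed.

HB.instance Definition _ := Measure_isFinite.Build _ _ _ prob_sum prob_sum_fin.

Lemma dominates_prob_suml : mu `<< prob_sum.
Proof.
apply/null_content_dominatesP => A mA SA0.
have /eqP : (mu A + nu A = 0)%E by rewrite -measure_addE.
by rewrite padde_eq0// => /andP[/eqP].
Qed.

Lemma dominates_prob_sumr : nu `<< prob_sum.
Proof.
apply/null_content_dominatesP => A mA SA0.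
have /eqP : (mu A + nu A = 0)%E by rewrite -measure_addE.
by rewrite padde_eq0// => /andP[_ /eqP].
Qed.

Lemma prob_sum_dominates la : mu `<< la -> nu `<< la -> prob_sum `<< la.
Proof.
move=> mula nula; apply/null_content_dominatesP => A mA lA0.
rewrite -[LHS]/(measure_add mu nu A) measure_addE.
have muA0 : mu A = 0%E by move/null_content_dominatesP : mula; exact.
have nuA0 : nu A = 0%E by move/null_content_dominatesP : nula; exact.
by rewrite [X in (X + _)%E]muA0 [X in (_ + X)%E]nuA0 adde0.
Qed.

End sum.

(* The squared Hellinger distance, computed with the dominating measure
   mu + nu; see [hellinger2E] for the independence of this choice and
   [hellinger2_EFin] for the finiteness of the integral. *)
Definition hellinger2 mu nu : R := hellinger2_wrt (prob_sum mu nu) mu nu.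

Lemma density_EFin mu la x : mu `<< la ->
  (density mu la x)%:E = Radon_Nikodym (charge_of_finite_measure mu) la x.
Proof. by move=> mula; rewrite fineK// Radon_Nikodym_fin_num. Qed.

Lemma measurable_density mu la : mu `<< la ->
  measurable_fun setT (density mu la).
Proof.
move=> mula; apply/measurable_EFinP.
rewrite (_ : _ \o _ = Radon_Nikodym (charge_of_finite_measure mu) la).
  exact: measurable_int (Radon_Nikodym_integrable _).
by apply/funext => x; exact: density_EFin.
Qed.

Lemma measurable_hellinger_integrand mu nu la : mu `<< la -> nu `<< la ->
  measurable_fun setT (hellinger_integrand mu nu la).
Proof.
move=> mula nula; have msqrt := continuous_measurable_fun (@sqrt_continuous R).
apply: measurable_funX; apply: measurable_funB.
- exact: measurableT_comp msqrt (measurable_density mula).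
- exact: measurableT_comp msqrt (measurable_density nula).
Qed.

Lemma integrable_hellinger_integrand mu nu la : mu `<< la -> nu `<< la ->
  la.-integrable setT (EFin \o hellinger_integrand mu nu la).
Proof.
move=> mula nula.
have idens (ka : probability X R) : ka `<< la ->
    la.-integrable setT (fun x => `|(density ka la x)%:E|)%E.
  move=> kala; apply: integrable_abse.
  rewrite (_ : (fun _ => _) = Radon_Nikodym (charge_of_finite_measure ka) la).
    exact: Radon_Nikodym_integrable.
  by apply/funext => x; exact: density_EFin.
apply: (le_integrable measurableT _ _
  (integrableD measurableT (idens _ mula) (idens _ nula))) => [|x _].
  by apply/measurable_EFinP; exact: measurable_hellinger_integrand.
rewrite /= lee_fin ger0_norm ?sqr_ge0// (le_trans _ (ler_norm _))//.
rewrite /hellinger_integrand.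
have sqr_sqrt_le (a : R) : Num.sqrt a ^+ 2 <= `|a|.
  have [a0|a0] := leP 0 a; first by rewrite sqr_sqrtr ?ler_norm.
  by rewrite ltr0_sqrtr// expr0n normr_ge0.
apply: le_trans (lerD (sqr_sqrt_le _) (sqr_sqrt_le _)).
rewrite sqrrB lerD2r lerBlDr lerDl.
by rewrite mulrn_wge0// mulr_ge0// sqrtr_ge0.
Qed.

Lemma hellinger2_EFin mu nu : (hellinger2 mu nu)%:E =
  (\int[prob_sum mu nu]_x (hellinger_integrand mu nu (prob_sum mu nu) x)%:E)%E.
Proof.
rewrite /hellinger2 /hellinger2_wrt /Rintegral fineK//.
apply: integrable_fin_num => //.
apply: integrable_hellinger_integrand.
  exact: dominates_prob_suml.
exact: dominates_prob_sumr.
Qed.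

Lemma hellinger2E mu nu la : mu `<< la -> nu `<< la ->
  hellinger2 mu nu = hellinger2_wrt la mu nu.
Proof.
move=> mula nula; rewrite /hellinger2 /hellinger2_wrt /Rintegral.
set S := prob_sum mu nu.
have muS : mu `<< S by exact: dominates_prob_suml.
have nuS : nu `<< S by exact: dominates_prob_sumr.
have Sla : S `<< la by exact: prob_sum_dominates.
set rho := Radon_Nikodym (charge_of_finite_measure S) la.
congr fine; rewrite -(Radon_Nikodym_change_of_variables Sla)//; last first.
  exact: integrable_hellinger_integrand.
apply: ae_eq_integral => //.
- apply: emeasurable_funM.
    by apply/measurable_EFinP; exact: measurable_hellinger_integrand.
  exact: measurable_int (Radon_Nikodym_integrable _).
- by apply/measurable_EFinP; exact: measurable_hellinger_integrand.
have rho_ge0 := ae_eq_Radon_Nikodym_SigmaFinite Sla measurableT.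
have mu_chain : ae_eq la setT _ _ :=
  Radon_Nikodym_chain_rule (nu := charge_of_finite_measure mu) muS Sla.
have nu_chain : ae_eq la setT _ _ :=
  Radon_Nikodym_chain_rule (nu := charge_of_finite_measure nu) nuS Sla.
apply: filterS3 rho_ge0 mu_chain nu_chain => x r0 muE nuE _.
have {}r0 : (0 <= rho x)%E.
  by have := Radon_Nikodym_SigmaFinite.f_ge0 Sla x; rewrite r0.
have rhoE : rho x = (fine (rho x))%:E.
  by rewrite fineK// Radon_Nikodym_fin_num.
have chain (ka : probability X R) : ka `<< S ->
    Radon_Nikodym (charge_of_finite_measure ka) la x =
      (Radon_Nikodym (charge_of_finite_measure ka) S x * rho x)%E ->
    density ka la x = density ka S x * fine (rho x).
  move=> kaS kaE; rewrite /density kaE fineM// ?Radon_Nikodym_fin_num//.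
rewrite -/rho rhoE -EFinM; congr EFin.
rewrite /hellinger_integrand (chain _ muS (muE I)) (chain _ nuS (nuE I)).
rewrite !(mulrC _ (fine (rho x))) !sqrtrM ?fine_ge0//.
by rewrite -mulrBr exprMn sqr_sqrtr// fine_ge0.
Qed.

End Hellinger.

(* Main.v *)
Require Import Defs.
From HB Require Import structures.
From mathcomp Require Import all_boot all_order all_algebra.
From mathcomp Require Import all_classical all_reals all_analysis.
From mathcomp Require Import measurable_realfun ring lra.

(** Write [r_mu] for the square root of the density of [mu] with respect to a
    dominating measure [la]. The map [mu |-> r_mu] embeds the probabilities in
    the unit sphere of L^2(la), with image the nonnegative unit vectors, and the
    squared Hellinger distance becomes [2 - 2 <r_mu, r_nu>]. The inner product
    [<r_mu, r_nu>], called affinity below, depends on [mu] and [nu] only.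

    Given the end points [mu0], [mu1] and the base point [eta], the chord
    [(1 - s) r_mu0 + s r_mu1] leaves the sphere, and it is pushed back to the
    sphere along [r_eta]:
      [phi_s = (1 - s) r_mu0 + s r_mu1 + t_s r_eta], with [t_s >= 0] such that
    [phi_s] has norm 1. Since [phi_s] is nonnegative, it is the square root of
    the density of a probability [x_s] ([probability_of_root_comb],
    [hellinger_path]). Then, for every [nu],
      [H^2(x_s, eta) - H^2(x_s, nu) = 2 <phi_s, r_nu - r_eta>
         = (affine in s) - 2 t_s (1 - <r_eta, r_nu>)].
    As [<r_eta, r_nu> <= 1], convexity in [s] for all [nu] at once reduces to
    concavity of [s |-> t_s].

    Solving the quadratic equation for [t_s] gives [t_s = sqrt (q s) - b s],
    where [b] is affine in [s] and [q] is a quadratic polynomial whose leading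
    coefficient is [|<r_mu1 - r_mu0, r_eta>|^2 - |r_mu1 - r_mu0|^2], which is
    nonpositive by the Cauchy-Schwarz inequality ([affinity_dist]). So [q] is
    concave and nonnegative on [0, 1], its square root is concave, and so is
    [t_s] ([path_shift_concave]). *)

Set Implicit Arguments.
Unset Strict Implicit.
Unset Printing Implicit Defensive.

Import Order.TTheory GRing.Theory Num.Theory.
Import numFieldNormedType.Exports.

Local Open Scope classical_set_scope.
Local Open Scope ring_scope.

(** * Measures given by a sum or by a density *)

Section sum_measure.
Context {d : measure_display} {X : measurableType d} {R : realType}.
Variables (kappa : nat -> probability X R) (n : nat).

Definition sum_measure : set X -> \bar R := msum kappa n.

HB.instance Definition _ := Measure.on sum_measure.

Let sum_measure_fin : fin_num_fun sum_measure.
Proof.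
by move=> U mU; apply/sum_fin_numP => i _ _; exact: fin_num_measure.
Qed.

HB.instance Definition _ :=
  Measure_isFinite.Build _ _ _ sum_measure sum_measure_fin.

Lemma dominates_sum_measure (i : 'I_n) : kappa i `<< sum_measure.
Proof.
apply/null_content_dominatesP => A mA SA0; apply/eqP.
rewrite -measure_le0 -[leRHS]SA0 /= /sum_measure /msum (bigD1 i)//= leeDl//.
by apply: sume_ge0 => *; exact: measure_ge0.
Qed.

Lemma sum_measure_dominates (la : {measure set X -> \bar R}) :
  (forall i : 'I_n, kappa i `<< la) -> sum_measure `<< la.
Proof.
move=> kla; apply/null_content_dominatesP => A mA lA0.
rewrite /sum_measure /msum big1// => i _.
by have /null_content_dominatesP := kla i; exact.
Qed.

End sum_measure.

Section density_measure.
Context {d : measure_display} {X : measurableType d} {R : realType}.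
Variables (m : {measure set X -> \bar R}) (f : X -> R).
Hypothesis mf : measurable_fun setT f.
Hypothesis f_ge0 : forall x, 0 <= f x.
Hypothesis f_int1 : (\int[m]_x (f x)%:E = 1)%E.

Definition density_measure (A : set X) : \bar R := (\int[m]_(x in A) (f x)%:E)%E.

Local Notation P := density_measure.

Let P0 : P set0 = 0%E. Proof. exact: integral_set0. Qed.

Let P_ge0 A : (0 <= P A)%E.
Proof. by apply: integral_ge0 => x _; rewrite lee_fin. Qed.

Let P_sigma_additive : semi_sigma_additive P.
Proof.
apply: semi_sigma_additive_nng_induced; first exact/measurable_EFinP.
by move=> x; rewrite lee_fin.
Qed.

HB.instance Definition _ := isMeasure.Build _ _ _ P P0 P_ge0 P_sigma_additive.

HB.instance Definition _ := @Measure_isProbability.Build _ _ R P f_int1.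

Lemma probability_of_density : exists Q : probability X R,
  forall A, Q A = (\int[m]_(x in A) (f x)%:E)%E.
Proof. by exists P. Qed.

End density_measure.

(** * Square roots of densities *)

Section root_density.
Context {d : measure_display} {X : measurableType d} {R : realType}.
Implicit Types (mu nu : probability X R)
  (la : {sigma_finite_measure set X -> \bar R}).

Definition root_density la mu (x : X) : R := Num.sqrt (density mu la x).

Lemma root_density_ge0 la mu x : 0 <= root_density la mu x.
Proof. exact: sqrtr_ge0. Qed.

Lemma measurable_root_density la mu : mu `<< la ->
  measurable_fun setT (root_density la mu).
Proof.
move=> mula.
exact: measurableT_comp (continuous_measurable_fun (@sqrt_continuous R))
  (measurable_density mula).
Qed.

(** [Radon_Nikodym] is chosen among signed functions; by uniqueness it agrees
    almost everywhere with a nonnegative version of the derivative. *)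
Lemma Radon_Nikodym_ge0 (m : {finite_measure set X -> \bar R}) la : m `<< la ->
  {ae la, forall x, 0 <= Radon_Nikodym (charge_of_finite_measure m) la x}%E.
Proof.
move=> mla; apply: filterS (ae_eq_Radon_Nikodym_SigmaFinite mla measurableT).
by move=> x <- //; exact: Radon_Nikodym_SigmaFinite.f_ge0.
Qed.

Lemma root_density_sqr la mu : mu `<< la ->
  {ae la, forall x, root_density la mu x ^+ 2 = density mu la x}.
Proof.
move=> mula; apply: filterS (Radon_Nikodym_ge0 mula) => x r0.
by rewrite sqr_sqrtr// fine_ge0.
Qed.

Lemma integral_root_density_sqr la mu A : mu `<< la -> measurable A ->
  (\int[la]_(x in A) (root_density la mu x ^+ 2)%:E = mu A)%E.
Proof.
move=> mula mA.
rewrite -[RHS]/(charge_of_finite_measure mu A).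
rewrite (Radon_Nikodym_integral (nu := charge_of_finite_measure mu) mula)//.
apply: ae_eq_integral => //.
- apply/measurable_EFinP/measurable_funTS/measurable_funX.
  exact: measurable_root_density.
- exact: measurable_funTS.
apply: filterS (root_density_sqr mula) => x -> _.
exact: density_EFin.
Qed.

(** Root densities are square integrable, and [u v <= u^2 + v^2]. *)
Lemma integrable_root_densityM la mu nu : mu `<< la -> nu `<< la ->
  la.-integrable setT
    (fun x => (root_density la mu x * root_density la nu x)%:E).
Proof.
move=> mula nula.
have isqr (ka : probability X R) : ka `<< la ->
    la.-integrable setT (fun x => (root_density la ka x ^+ 2)%:E).
  move=> kala; apply/integrableP; split.
    by apply/measurable_EFinP/measurable_funX; exact: measurable_root_density.
  under eq_integral do rewrite abse_EFin ger0_norm ?sqr_ge0//.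
  by rewrite (integral_root_density_sqr kala measurableT)
    (le_lt_trans (probability_le1 _ _))// ltry.
apply: (le_integrable measurableT _ _
  (integrableD measurableT (isqr _ mula) (isqr _ nula))) => [|x _].
  by apply/measurable_EFinP/measurable_funM; exact: measurable_root_density.
have := root_density_ge0 la mu x; have := root_density_ge0 la nu x.
move: (root_density la mu x) (root_density la nu x) => u v v0 u0.
rewrite /= lee_fin !ger0_norm ?addr_ge0 ?mulr_ge0 ?exprn_ge0//.
by have := sqr_ge0 (u - v); nra.
Qed.

(** The Bhattacharyya coefficient. Defining it from the Hellinger distance,
    rather than by an integral, makes it visibly free of the dominating
    measure; [affinityE] recovers the integral for any such measure. *)
Definition affinity mu nu : R := 1 - hellinger2 mu nu / 2.

Lemma hellinger2_affinity mu nu : hellinger2 mu nu = 2 - 2 * affinity mu nu.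
Proof. by rewrite /affinity; field. Qed.

(** The formula [H^2 = |r_mu|^2 + |r_nu|^2 - 2 <r_mu, r_nu>], where both
    norms are 1. *)
Lemma affinityE la mu nu : mu `<< la -> nu `<< la ->
  affinity mu nu =
    \int[la]_x (root_density la mu x * root_density la nu x).
Proof.
move=> mula nula; rewrite /affinity (hellinger2E mula nula) /hellinger2_wrt.
have int1 (ka : probability X R) : ka `<< la ->
    \int[la]_x (root_density la ka x * root_density la ka x) = 1.
  move=> kala; rewrite /Rintegral.
  under eq_integral do rewrite -expr2.
  by rewrite (integral_root_density_sqr kala measurableT) probability_setT.
have i2 := integrable_root_densityM.
under eq_Rintegral => x _.
  rewrite /hellinger_integrand -/(root_density la mu x) -/(root_density la nu x).
  have -> : (root_density la mu x - root_density la nu x) ^+ 2 =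
    root_density la mu x * root_density la mu x
    + root_density la nu x * root_density la nu x
    - 2 * (root_density la mu x * root_density la nu x) by ring.
  over.
rewrite RintegralB//; last 2 first.
- exact: integrableD (i2 _ _ _ mula mula) (i2 _ _ _ nula nula).
- exact: integrableZl (i2 _ _ _ mula nula).
rewrite RintegralD//; [|exact: i2..].
rewrite RintegralZl//; last exact: i2.
by rewrite !int1//; field.
Qed.

Lemma affinity_ge0 mu nu : 0 <= affinity mu nu.
Proof.
rewrite (affinityE (@dominates_prob_suml _ _ _ mu nu)
  (@dominates_prob_sumr _ _ _ mu nu)).
by apply: Rintegral_ge0 => x _; rewrite mulr_ge0// root_density_ge0.
Qed.

Lemma affinity_le1 mu nu : affinity mu nu <= 1.
Proof.
rewrite /affinity lerBlDr lerDl divr_ge0//.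
by apply: Rintegral_ge0 => x _; exact: sqr_ge0.
Qed.

Lemma affinityxx mu : affinity mu mu = 1.
Proof.
rewrite /affinity /hellinger2 /hellinger2_wrt /hellinger_integrand.
under eq_Rintegral do rewrite subrr expr0n/=.
by rewrite Rintegral_cst// mul0r mul0r subr0.
Qed.

Lemma affinityC mu nu : affinity mu nu = affinity nu mu.
Proof.
have muS := @dominates_prob_suml _ _ _ mu nu.
have nuS := @dominates_prob_sumr _ _ _ mu nu.
rewrite (affinityE muS nuS) (affinityE nuS muS).
by apply: eq_Rintegral => x _; rewrite mulrC.
Qed.

End root_density.

(** * Linear combinations of root densities *)

Section combination.
Context {d : measure_display} {X : measurableType d} {R : realType}.

Lemma Rintegral_sum (m : {measure set X -> \bar R}) (n : nat)
    (f : 'I_n -> X -> R) :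
  (forall i, m.-integrable setT (EFin \o f i)) ->
  m.-integrable setT (EFin \o (fun x => \sum_(i < n) f i x)) /\
  \int[m]_x (\sum_(i < n) f i x) = \sum_(i < n) \int[m]_x f i x.
Proof.
move=> intf; split.
  rewrite (_ : _ \o _ = fun x => (\sum_(i < n) (f i x)%:E)%E).
    by apply: integrable_sum => // i _; exact: intf.
  by apply/funext => x /=; rewrite sumEFin.
rewrite /Rintegral.
under eq_integral do rewrite -sumEFin.
rewrite integral_sum// -sum_fine// => i _.
by apply: integrable_fin_num => //; exact: intf.
Qed.

Variables (n : nat) (kappa : nat -> probability X R) (u : nat -> R).
Implicit Type la : {sigma_finite_measure set X -> \bar R}.

Definition root_comb la (x : X) : R :=
  \sum_(i < n) u i * root_density la (kappa i) x.

Lemma measurable_root_comb la : (forall i : 'I_n, kappa i `<< la) ->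
  measurable_fun setT (root_comb la).
Proof.
move=> kla; apply: measurable_sum => i.
by apply: measurable_funM => //; exact: measurable_root_density.
Qed.

Lemma Rintegral_root_combM la (nu : probability X R) :
  (forall i : 'I_n, kappa i `<< la) -> nu `<< la ->
  la.-integrable setT
    (EFin \o (fun x => root_comb la x * root_density la nu x)) /\
  \int[la]_x (root_comb la x * root_density la nu x) =
    \sum_(i < n) u i * affinity (kappa i) nu.
Proof.
move=> kla nula.
pose g (i : 'I_n) x := u i * (root_density la (kappa i) x * root_density la nu x).
have -> : (fun x => root_comb la x * root_density la nu x) =
    (fun x => \sum_(i < n) g i x).
  by apply/funext => x; rewrite mulr_suml; apply: eq_bigr => i _; rewrite /g mulrA.
have ig i : la.-integrable setT (EFin \o g i).
  exact: integrableZl (integrable_root_densityM (kla i) nula).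
have [ig' ->] := Rintegral_sum ig; split => //.
apply: eq_bigr => i _; rewrite (affinityE (kla i) nula) -RintegralZl//.
exact: integrable_root_densityM (kla i) nula.
Qed.

Lemma Rintegral_root_comb_sqr la : (forall i : 'I_n, kappa i `<< la) ->
  la.-integrable setT (EFin \o (fun x => root_comb la x ^+ 2)) /\
  \int[la]_x (root_comb la x ^+ 2) =
    \sum_(i < n) \sum_(j < n) u i * u j * affinity (kappa i) (kappa j).
Proof.
move=> kla.
pose g (j : 'I_n) x := u j * (root_comb la x * root_density la (kappa j) x).
have -> : (fun x => root_comb la x ^+ 2) = (fun x => \sum_(j < n) g j x).
  apply/funext => x; rewrite expr2 {2}/root_comb mulr_sumr.
  by apply: eq_bigr => j _; rewrite mulrCA.
have ig j : la.-integrable setT (EFin \o g j).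
  exact: integrableZl (Rintegral_root_combM kla (kla j)).1.
have [ig' ->] := Rintegral_sum ig; split => //.
rewrite exchange_big/=; apply: eq_bigr => j _.
have [icomb comb] := Rintegral_root_combM kla (kla j).
rewrite /g RintegralZl// comb mulr_sumr.
by apply: eq_bigr => i _; rewrite mulrA (mulrC (u j)).
Qed.

(** The Gram matrix of a family of vectors is positive semidefinite. *)
Lemma affinity_gram_ge0 :
  0 <= \sum_(i < n) \sum_(j < n) u i * u j * affinity (kappa i) (kappa j).
Proof.
have [_ <-] := Rintegral_root_comb_sqr (@dominates_sum_measure _ _ _ kappa n).
by apply: Rintegral_ge0 => x _; exact: sqr_ge0.
Qed.

(** By the chain rule, passing from [m] to a larger measure [la] multiplies all
    root densities by the same function, the square root of [dm/dla]. *)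
Lemma root_comb_change (m : {finite_measure set X -> \bar R}) la :
  (forall i : 'I_n, kappa i `<< m) -> m `<< la ->
  {ae la, forall x, root_comb la x = root_comb m x *
    Num.sqrt (fine (Radon_Nikodym (charge_of_finite_measure m) la x))}.
Proof.
move=> km mla.
have chain (i : 'I_n) : ae_eq la setT _ _ :=
  Radon_Nikodym_chain_rule (nu := charge_of_finite_measure (kappa i)) (km i) mla.
have chain_all : {ae la, forall x, forall i : 'I_n,
    density (kappa i) la x = density (kappa i) m x *
      fine (Radon_Nikodym (charge_of_finite_measure m) la x)}.
  apply: filter_forall => i.
  apply: filterS (chain i) => x /(_ I) E.
  by rewrite /density E fineM// Radon_Nikodym_fin_num//; exact: km.
apply: filterS2 (Radon_Nikodym_ge0 mla) chain_all => x r0 E.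
rewrite /root_comb mulr_suml; apply: eq_bigr => i _.
by rewrite /root_density E (mulrC (density _ _ _)) sqrtrM ?fine_ge0// mulrA mulrAC.
Qed.

(** A nonnegative combination of root densities whose norm, computed by the Gram
    matrix, is 1 is again the root density of a probability [P]. The measure
    used to define [P] dominates only the given family, whereas [nu] is
    arbitrary: so the density of [P] has to be identified with respect to a
    larger measure that also dominates [nu]. *)
Lemma probability_of_root_comb :
  (forall i, 0 <= u i) ->
  \sum_(i < n) \sum_(j < n) u i * u j * affinity (kappa i) (kappa j) = 1 ->
  exists P : probability X R, forall nu,
    affinity P nu = \sum_(i < n) u i * affinity (kappa i) nu.
Proof.
move=> u_ge0 gram1; pose m := sum_measure kappa n.
have km := @dominates_sum_measure _ _ _ kappa n.
have [iphi phi1] := Rintegral_root_comb_sqr km.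
have comb_ge0 la x : 0 <= root_comb la x.
  by apply: sumr_ge0 => i _; rewrite mulr_ge0// root_density_ge0.
have [|||P PE] := @probability_of_density _ _ _ m (fun x => root_comb m x ^+ 2).
- by apply: measurable_funX; exact: measurable_root_comb.
- by move=> x; exact: sqr_ge0.
- rewrite -[LHS]fineK; last exact: integrable_fin_num iphi.
  by congr EFin; rewrite -gram1 -phi1.
exists P => nu.
pose kappa' i := if (i == n)%N then nu else kappa i.
pose la : {finite_measure set X -> \bar R} := sum_measure kappa' n.+1.
have nula : nu `<< la.
  have := @dominates_sum_measure _ _ _ kappa' n.+1 ord_max.
  by rewrite /kappa' /= eqxx.
have kla (i : 'I_n) : kappa i `<< la.
  have := @dominates_sum_measure _ _ _ kappa' n.+1 (widen_ord (leqnSn n) i).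
  by rewrite /kappa' /= ltn_eqF.
have mla : m `<< la by exact: sum_measure_dominates.
have Pla : P `<< la.
  apply: null_dominates_trans mla; apply/null_content_dominatesP => A mA mA0.
  rewrite PE null_set_integral//; apply/measurable_EFinP.
  by apply: measurable_funTS; apply: measurable_funX; exact: measurable_root_comb.
(* Both sides have integral [P A] over every measurable set [A]. *)
have PE' : {ae la, forall x, density P la x = root_comb la x ^+ 2}.
  have : ae_eq la setT (Radon_Nikodym (charge_of_finite_measure P) la)
      (fun x => (root_comb la x ^+ 2)%:E).
    apply: integral_ae_eq => //.
    - exact: Radon_Nikodym_integrable.
    - by apply/measurable_EFinP/measurable_funX; exact: measurable_root_comb.
    move=> A _ mA.
    rewrite -(Radon_Nikodym_integral (nu := charge_of_finite_measure P) Pla)//.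
    rewrite -[LHS]/(P A) PE -(Radon_Nikodym_change_of_variables mla)//; last first.
      exact: integrableS iphi.
    apply: ae_eq_integral => //.
    - apply: emeasurable_funM; last exact: measurable_funTS.
      apply/measurable_EFinP/measurable_funTS/measurable_funX.
      exact: measurable_root_comb.
    - apply/measurable_EFinP/measurable_funTS/measurable_funX.
      exact: measurable_root_comb.
    apply: filterS2 (root_comb_change km mla) (Radon_Nikodym_ge0 mla).
    move=> x E r0 _; rewrite [in RHS]E exprMn sqr_sqrtr ?fine_ge0//.
    by rewrite [RHS]EFinM fineK// Radon_Nikodym_fin_num.
  by apply: filterS => x /(_ I) E; rewrite /density E.
have rootP : {ae la, forall x, root_density la P x = root_comb la x}.
  apply: filterS PE' => x E.
  by rewrite /root_density E sqrtr_sqr ger0_norm.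
have [_ <-] := Rintegral_root_combM kla nula.
rewrite (affinityE Pla nula) /Rintegral; congr fine.
apply: ae_eq_integral => //.
- by apply/measurable_EFinP/measurable_funM; exact: measurable_root_density.
- apply/measurable_EFinP/measurable_funM; last exact: measurable_root_density.
  exact: measurable_root_comb.
by apply: filterS rootP => x -> _.
Qed.

End combination.

(** The Cauchy-Schwarz inequality for [r_mu1 - r_mu0] and the unit vector
    [r_nu]. The vector of nonnegative squared norm used here is the component of
    [r_mu1 - r_mu0] orthogonal to [r_nu]. *)
Lemma affinity_dist {d : measure_display} {X : measurableType d} {R : realType}
    (mu0 mu1 nu : probability X R) :
  (affinity mu1 nu - affinity mu0 nu) ^+ 2 <= 2 * (1 - affinity mu0 mu1).
Proof.
set k := affinity mu1 nu - affinity mu0 nu.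
have := affinity_gram_ge0 3 (nth nu [:: mu0; mu1]) (nth (- k) [:: -1; 1]).
rewrite !big_ord_recl !big_ord0/= !affinityxx.
rewrite (affinityC mu1 mu0) (affinityC nu mu0) (affinityC nu mu1).
have : k = affinity mu1 nu - affinity mu0 nu by [].
by move: (affinity mu1 nu) (affinity mu0 nu) (affinity mu0 mu1) => p1 p0 a; nra.
Qed.

(** * The coefficient of the correction along the base point *)

(** Here [a], [p0], [p1] stand for the inner products [<r_mu0, r_mu1>],
    [<r_mu0, r_eta>], [<r_mu1, r_eta>]. *)
Section path.
Context {R : realType}.
Variables a p0 p1 : R.

(** The inner product of the chord with [r_eta]. *)
Definition path_aff s : R := (1 - s) * p0 + s * p1.

(** The reduced discriminant of the equation for [t] that the norm of
    [chord + t r_eta] be 1; the squared norm of the chord is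
    [1 - 2 s (1 - s) (1 - a)]. *)
Definition path_disc s : R := path_aff s ^+ 2 + 2 * s * (1 - s) * (1 - a).

(** The larger root of that equation. *)
Definition path_shift s : R := Num.sqrt (path_disc s) - path_aff s.

Hypotheses (a_le1 : a <= 1) (p0_ge0 : 0 <= p0) (p1_ge0 : 0 <= p1).

Lemma path_aff_ge0 s : 0 <= s <= 1 -> 0 <= path_aff s.
Proof.
by case/andP=> s0 s1; rewrite addr_ge0// mulr_ge0// subr_ge0.
Qed.

Lemma path_disc_ge s : 0 <= s <= 1 -> path_aff s ^+ 2 <= path_disc s.
Proof.
by case/andP=> s0 s1; rewrite lerDl !mulr_ge0// subr_ge0.
Qed.

Lemma path_shift_ge0 s : 0 <= s <= 1 -> 0 <= path_shift s.
Proof.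
move=> s01; rewrite subr_ge0 -[leLHS]ger0_norm ?path_aff_ge0//.
by rewrite -sqrtr_sqr ler_wsqrtr// path_disc_ge.
Qed.

Lemma path_shift0 : path_shift 0 = 0.
Proof.
rewrite /path_shift /path_disc mulr0 !mul0r addr0 sqrtr_sqr.
by rewrite ger0_norm ?subrr// path_aff_ge0// lexx ler01.
Qed.

Lemma path_shift1 : path_shift 1 = 0.
Proof.
rewrite /path_shift /path_disc subrr mulr0 !mul0r addr0 sqrtr_sqr.
by rewrite ger0_norm ?subrr// path_aff_ge0// lexx ler01.
Qed.

Lemma path_normalized s : 0 <= s <= 1 ->
  (1 - s) ^+ 2 + s ^+ 2 + 2 * s * (1 - s) * a + path_shift s ^+ 2
  + 2 * path_shift s * path_aff s = 1.
Proof.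
move=> s01; have : (path_shift s + path_aff s) ^+ 2 = path_disc s.
  rewrite subrK sqr_sqrtr//.
  exact: le_trans (sqr_ge0 _) (path_disc_ge s01).
by move: (path_shift s) => t; rewrite /path_disc; nra.
Qed.

Hypothesis p_dist : (p1 - p0) ^+ 2 <= 2 * (1 - a).

(** [path_disc] is a quadratic polynomial with nonpositive leading coefficient,
    hence concave; its square root is concave because the square root is
    nondecreasing and concave, and [path_aff] is affine. *)
Lemma path_shift_concave l s t : 0 <= l <= 1 -> 0 <= s <= 1 -> 0 <= t <= 1 ->
  l * path_shift s + (1 - l) * path_shift t <=
    path_shift (l * s + (1 - l) * t).
Proof.
move=> /andP[l0 l1] s01 t01.
have disc_ge0 r : 0 <= r <= 1 -> 0 <= path_disc r.
  by move=> r01; exact: le_trans (sqr_ge0 _) (path_disc_ge r01).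
have disc_concave : l * path_disc s + (1 - l) * path_disc t <=
    path_disc (l * s + (1 - l) * t).
  rewrite -subr_ge0.
  have -> : path_disc (l * s + (1 - l) * t) -
      (l * path_disc s + (1 - l) * path_disc t) =
    l * (1 - l) * (s - t) ^+ 2 * (2 * (1 - a) - (p1 - p0) ^+ 2).
    by rewrite /path_disc /path_aff; ring.
  apply: mulr_ge0; last by rewrite subr_ge0.
  by apply: mulr_ge0 (sqr_ge0 _); rewrite mulr_ge0 ?subr_ge0.
suff sqrt_concave : l * Num.sqrt (path_disc s) + (1 - l) * Num.sqrt (path_disc t)
    <= Num.sqrt (path_disc (l * s + (1 - l) * t)).
  have -> : l * path_shift s + (1 - l) * path_shift t =
    l * Num.sqrt (path_disc s) + (1 - l) * Num.sqrt (path_disc t)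
    - path_aff (l * s + (1 - l) * t).
    by rewrite /path_shift /path_aff; ring.
  by rewrite lerD2r.
set X := Num.sqrt (path_disc s); set Y := Num.sqrt (path_disc t).
have XE : X ^+ 2 = path_disc s by rewrite sqr_sqrtr// disc_ge0.
have YE : Y ^+ 2 = path_disc t by rewrite sqr_sqrtr// disc_ge0.
have XY0 : 0 <= l * X + (1 - l) * Y.
  by rewrite addr_ge0// mulr_ge0 ?sqrtr_ge0// subr_ge0.
rewrite -[leLHS]ger0_norm// -sqrtr_sqr ler_wsqrtr//.
apply: le_trans disc_concave; rewrite -XE -YE -subr_ge0.
have -> : l * X ^+ 2 + (1 - l) * Y ^+ 2 - (l * X + (1 - l) * Y) ^+ 2 =
  l * (1 - l) * (X - Y) ^+ 2 by ring.
by apply: mulr_ge0 (sqr_ge0 _); rewrite mulr_ge0 ?subr_ge0.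
Qed.

End path.

(** * The Hellinger path *)

Section hellinger_path.
Context {d : measure_display} {X : measurableType d} {R : realType}.

Lemma hellinger_path (mu0 mu1 eta : probability X R) (s : R) : 0 <= s <= 1 ->
  exists P : probability X R, forall nu, affinity P nu =
    (1 - s) * affinity mu0 nu + s * affinity mu1 nu +
    path_shift (affinity mu0 mu1) (affinity mu0 eta) (affinity mu1 eta) s
      * affinity eta nu.
Proof.
move=> s01.
set t := path_shift _ _ _ _.
have [i||P PE] := @probability_of_root_comb _ X R 3
  (nth eta [:: mu0; mu1]) (nth 0 [:: 1 - s; s; t]).
- case/andP: (s01) => s0 s1.
  case: i => [|[|[|i]]] //=; [by rewrite subr_ge0| |by rewrite nth_nil].
  by apply: path_shift_ge0 => //; [exact: affinity_le1|exact: affinity_ge0..].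
- rewrite !big_ord_recl !big_ord0/= !affinityxx.
  rewrite (affinityC mu1 mu0) (affinityC eta mu0) (affinityC eta mu1).
  have := path_normalized (affinity mu0 eta) (affinity mu1 eta)
    (affinity_le1 mu0 mu1) s01.
  by rewrite -/t /path_aff => norm1; rewrite -[RHS]norm1; ring.
- exists P => nu; rewrite PE !big_ord_recl !big_ord0/=; ring.
Qed.

Lemma hellinger2_diff (mu nu eta : probability X R) :
  hellinger2 mu eta - hellinger2 mu nu = 2 * (affinity mu nu - affinity mu eta).
Proof. by rewrite !hellinger2_affinity; ring. Qed.

(** Up to an affine function of [s], the difference of costs is
    [- 2 (1 - affinity eta nu)] times the concave function [shift]. *)
Lemma hellinger2_NNCC_conv :
  NNCC_conv (fun mu nu : probability X R => hellinger2 mu nu).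
Proof.
move=> mu0 mu1 eta.
pose shift := path_shift (affinity mu0 mu1) (affinity mu0 eta) (affinity mu1 eta).
have shift0 : shift 0 = 0 by apply: path_shift0; exact: affinity_ge0.
have shift1 : shift 1 = 0 by apply: path_shift1; exact: affinity_ge0.
(* At [s = 0] and [s = 1] the correction vanishes, so the end points themselves
   satisfy the formula and can be chosen. *)
have ex (s : R) : exists P : probability X R,
    [/\ s = 0 -> P = mu0, s = 1 -> P = mu1 &
    0 <= s <= 1 -> forall nu, affinity P nu =
      (1 - s) * affinity mu0 nu + s * affinity mu1 nu +
      shift s * affinity eta nu].
  have [->|s0] := eqVneq s 0.
    exists mu0; split => // [/eqP|_ nu]; first by rewrite eq_sym oner_eq0.
    by rewrite shift0; ring.
  have [->|s1] := eqVneq s 1.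
    exists mu1; split => // [/eqP|_ nu]; first by rewrite oner_eq0.
    by rewrite shift1; ring.
  have [s01|s01] := boolP (0 <= s <= 1).
    have [P PE] := hellinger_path mu0 mu1 eta s01.
    by exists P; split => // /eqP; rewrite ?(negbTE s0) ?(negbTE s1).
  by exists mu0; split => // /eqP; rewrite (negbTE s1).
have [x xE] := choice ex; exists x; split => [||nu l s t].
- by have [->] := xE 0.
- by have [_ ->] := xE 1.
rewrite !inE/= !in_itv/= => s01 t01.
have l01 : 0 <= l%:num <= 1 by apply/andP.
have r01 : 0 <= l%:num * s + (1 - l%:num) * t <= 1.
  by move: s01 t01 l01 => /andP[? ?] /andP[? ?] /andP[? ?]; apply/andP; split; nra.
rewrite !convRE /unstable.onem !hellinger2_diff.
have [_ _ /(_ s01) xs] := xE s; have [_ _ /(_ t01) xt] := xE t.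
have [_ _ /(_ r01) xr] := xE (l%:num * s + (1 - l%:num) * t).
rewrite -[X in x X]/(l%:num * s + (1 - l%:num) * t).
rewrite !xs !xt !xr affinityxx.
have := path_shift_concave (affinity_le1 mu0 mu1)
  (affinity_dist mu0 mu1 eta) l01 s01 t01.
rewrite -/shift; have := affinity_le1 eta nu.
set r := l%:num * s + _.
move: (shift s) (shift t) (shift r) (affinity eta nu) => ss st sr k k1 conc.
rewrite -subr_ge0.
rewrite [leRHS](_ : _ = 2 * (1 - k) * (sr - (l%:num * ss + (1 - l%:num) * st))).
  by rewrite !mulr_ge0 ?subr_ge0.
by rewrite /r; ring.
Qed.

End hellinger_path.

Lemma NNCC_conv_space (R : realType) (A B : Type) (c : A -> B -> R) :
  NNCC_conv c -> NNCC_space c.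
Proof.
move=> cconv x0 x1 ybar; have [x [x0E x1E xconv]] := cconv x0 x1 ybar.
exists x; split => // s y /andP[s0 s1].
have := xconv y (Itv01 (ltW s0) (ltW s1)) 1 0.
rewrite !inE/= !in_itv/= !lexx !ler01 => /(_ isT isT).
rewrite !convRE /unstable.onem/= x0E x1E [leRHS]addrC.
set r := (X in x X); suff -> : r = s by [].
by rewrite -[r]/(s * 1 + (1 - s) * 0) mulr1 mulr0 addr0.
Qed.

Theorem corollary4p4 (R : realType) (d : measure_display)
    (X : measurableType d) :
  NNCC_conv (fun mu nu : probability X R => hellinger2 mu nu) /\
  NNCC_space (fun mu nu : probability X R => hellinger2 mu nu).
Proof.
have H := @hellinger2_NNCC_conv d X R; split => //.
exact: NNCC_conv_space.
Qed.
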